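(* Let $\mathcal{G}=(V,E)$ be a finite tree with at least three vertices, with boundary $\delta\Omega$ (the set of vertices of degree one) and interior $\Omega=V\setminus\delta\Omega$, such that $\deg(x)\le D$ for every $x\in V$, where $D$ is a positive integer. If $\deg(x)\geq 3$ for every $x\in\Omega$, then for every integer $k$ with $1\le k\le|\delta\Omega|$ the $k$-th Steklov eigenvalue $\lambda_k$ of $(\mathcal{G},\delta\Omega)$ satisfies $$\lambda_k\leq \frac{16(D-1)^2(k-1)}{|V|+2}.$$
   Context: Let $\mathcal{G}=(V,E)$ be a finite tree (simple, undirected, unweighted) with at least three vertices. Its boundary $\delta\Omega$ is the set of vertices of degree one and its interior is $\Omega=V\setminus\delta\Omega$; $|\cdot|$ denotes cardinality. The Steklov problem on $(\mathcal{G},\delta\Omega)$ is: for nonzero $f\in\mathbb{R}^V$ and $\lambda\in\mathbb{R}$, $\Delta f(x)=0$ for $x\in\Omega$ and $\frac{\partial f}{\partial n}(x)=\lambda f(x)$ for $x\in\delta\Omega$, where $(\Delta f)(x)=\sum_{y\sim x}(f(x)-f(y))$ and $\frac{\partial f}{\partial n}(x)=\sum_{y\in\Omega,\,y\sim x}(f(x)-f(y))$. The Steklov eigenvalues are the eigenvalues of the Dirichlet-to-Neumann operator on $\mathbb{R}^{\delta\Omega}$, $f\mapsto \frac{\partial\hat f}{\partial n}$, where $\hat f$ is the harmonic extension of $f$ ($\Delta\hat f=0$ on $\Omega$, $\hat f=f$ on $\delta\Omega$). This operator is self-adjoint and non-negative; its eigenvalues, counted with multiplicity, are ordered $0=\lambda_1\le\lambda_2\le\cdots\le\lambda_{|\delta\Omega|}$.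 *)

(* Defs.v *)
From HB Require Import structures.
From mathcomp Require Import all_boot all_order all_algebra.
From mathcomp Require Import boolp classical_sets reals complex.
From mathcomp Require Import spectral sesquilinear.
From mathcomp Require Import ring.

Set Implicit Arguments.
Unset Strict Implicit.
Unset Printing Implicit Defensive.

Import Order.TTheory GRing.Theory Num.Theory.
Import passmx.

Local Open Scope ring_scope.

Section Graph.
Variables (V : finType) (e : rel V).

(* A closed walk x, y, x along a single edge satisfies [ucycle], hence the
   lower bound on the length. *)
Definition acyclic : Prop :=
  forall c : seq V, (2 < size c)%N -> ~ ucycle e c.

Definition is_tree : Prop :=
  [/\ symmetric e, irreflexive e, forall x y, connect e x y & acyclic].

Definition deg (x : V) : nat := #|[set y | e x y]|.

Definition boundary : {set V} := [set x | deg x == 1]%N.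

Definition interior : {set V} := ~: boundary.

Definition bvertex : finType := {x : V | x \in boundary}.

End Graph.

Section Steklov.
Variables (R : realType) (V : finType) (e : rel V).

Definition laplacian (f : V -> R) (x : V) : R :=
  \sum_(y | e x y) (f x - f y).

Definition normal_derivative (f : V -> R) (x : V) : R :=
  \sum_(y in interior e | e x y) (f x - f y).

(* [R^o] is [R] as a vector space over itself; it makes the function spaces
   below finite dimensional vector spaces. *)
Definition is_harmonic_extension (g : {ffun bvertex e -> R^o})
    (h : {ffun V -> R^o}) : Prop :=
  (forall x, x \in interior e -> laplacian h x = 0) /\
  (forall x : bvertex e, h (val x) = g x).

(* On a connected graph the extension exists and, if the boundary is nonempty,
   is unique: see [harmonic_extensionP] and [harmonic_extension_unique]. *)
Definition harmonic_extension (g : {ffun bvertex e -> R^o}) :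
    {ffun V -> R^o} :=
  xget 0 [set h | is_harmonic_extension g h]%classic.

Definition dtn_fun (g : {ffun bvertex e -> R^o}) : {ffun bvertex e -> R^o} :=
  [ffun x => normal_derivative (harmonic_extension g) (val x)].

(* The Dirichlet-to-Neumann operator as a linear endomorphism; see [dtnE]. *)
Definition dtn : 'End({ffun bvertex e -> R^o}) := linfun dtn_fun.

(* The operator is self-adjoint ([dtn_selfadjoint]), so the multiplicity of an
   eigenvalue is the dimension of its eigenspace.  [s] lists the eigenvalues in
   nondecreasing order, each repeated according to its multiplicity. *)
Definition is_steklov_spectrum (s : seq R) : Prop :=
  [/\ sorted <=%R s, size s = #|boundary e|
    & forall a : R, count_mem a s = \dim (leigenspace dtn a)].

(* Well defined on connected graphs, by [steklov_spectrumP]; such a list is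
   unique since it is sorted and its multiplicities are prescribed. *)
Definition steklov_spectrum : seq R :=
  xget [::] [set s | is_steklov_spectrum s]%classic.

(* Eigenvalues are numbered from 1. *)
Definition steklov_eigenvalue (k : nat) : R := nth 0 steklov_spectrum k.-1.

End Steklov.

Lemma rank_diag_mx (F : fieldType) n (v : 'rV[F]_n) :
  \rank (diag_mx v) = #|[pred i | v 0 i != 0]|.
Proof.
have -> :
    (diag_mx v :=: \sum_(i | v 0 i != 0) <<delta_mx 0 i : 'rV[F]_n>>)%MS.
  apply/eqmxP/andP; split.
    apply/row_subP => i; rewrite row_diag_mx.
    have [->|nz] := eqVneq (v 0 i) 0; first by rewrite scale0r sub0mx.
    by rewrite scalemx_sub // (sumsmx_sup i) // genmxE.
  apply/sumsmx_subP => i nz; rewrite genmxE.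
  rewrite -(scalerK nz (delta_mx 0 i)) scalemx_sub //.
  by rewrite -row_diag_mx row_sub.
rewrite (mxdirectP (mxdirect_delta F (f := id) _)) /=; last by move=> i j.
rewrite -sum1_card; apply: eq_bigr => i _.
by rewrite genmxE mxrank_delta.
Qed.

Lemma symmetric_mx_spectrum (R : realType) n (A : 'M[R]_n) :
  (forall i j, A i j = A j i) ->
  exists s : seq R, [/\ sorted <=%R s, size s = n
     & forall a, count_mem a s = \rank (eigenspace A a)].
Proof.
move=> symA.
pose toC : R -> R[i] := real_complex R.
pose B := map_mx toC A.
have hB : B \is hermsymmx.
  apply: realsym_hermsym.
    apply/is_hermitianmxP; rewrite expr0 scale1r map_mx_id //.
    by apply/matrixP=> i j; rewrite !mxE symA.
  by apply/mxOverP => i j; rewrite mxE complex_real.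
have /hermitian_normalmx/orthomx_spectralP Beq := hB.
have dreal := hermitian_spectral_diag_real hB.
set P := spectralmx B in Beq; set d := spectral_diag B in Beq dreal.
pose s := [seq complex.Re (d 0 i) | i <- enum 'I_n].
exists (sort <=%R s); split.
- exact: sort_le_sorted.
- by rewrite size_sort size_map size_enum_ord.
- move=> a; have /permP -> : perm_eq (sort <=%R s) s by rewrite perm_sort.
  rewrite count_map.
  have Pu : P \in unitmx by apply: spectral_unit.
  have -> : \rank (eigenspace A a) = (n - \rank (diag_mx d - (toC a)%:M)%R)%N.
    rewrite /eigenspace mxrank_ker; congr (n - _)%N.
    rewrite -(mxrank_map (real_complex R)) map_mxB -/toC -/B map_scalar_mx Beq.
    have -> : invmx P *m diag_mx d *m P - (toC a)%:M =
        invmx P *m (diag_mx d - (toC a)%:M) *m P.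
      by rewrite mulmxBr mulmxBl mul_mx_scalar -scalemxAl mulVmx // scalemx1.
    rewrite mxrankMfree ?row_free_unit // eqmxMfull //.
    by rewrite row_full_unit unitmx_inv.
  have -> : diag_mx d - (toC a)%:M = diag_mx (d - const_mx (toC a)).
    by rewrite -diag_const_mx linearB.
  rewrite rank_diag_mx.
  set w := d - _.
  rewrite -[X in (X - _)%N]card_ord -(cardC [pred i | w 0 i == 0]) addnK.
  rewrite -size_filter cardE /enum_mem -enumT; congr size.
  rewrite -filter_predI; apply: eq_filter => i; rewrite !inE !mxE subr_eq0.
  have /mxOverP/(_ 0 i)/RRe_real {2}<- := dreal.
  by rewrite /toC /= eq_complex /= eqxx andbT.
Qed.

Lemma dim_vsof (F : fieldType) (vT : vectType F)
    (e : (\dim {:vT}).-tuple vT) (M : 'M[F]_(\dim {:vT})) :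
  basis_of fullv e -> \dim (vsof e M) = \rank M.
Proof.
move=> be; pose B := row_base M.
pose w := [tuple vecof e (row i B) | i < \rank M].
have wE (k : 'I_(\rank M) -> F) :
    \sum_i k i *: w`_i = vecof e ((\row_i k i) *m B).
  rewrite mulmx_sum_row linear_sum /=; apply: eq_bigr => i _.
  have -> : w`_i = vecof e (row i B) by rewrite -tnth_nth tnth_mktuple.
  by rewrite linearZ /= mxE.
have fw : free w.
  apply/freeP => k; rewrite wE => /eqP; rewrite (vecof_eq0 be).
  rewrite mulmx_free_eq0 ?row_base_free // => /eqP/rowP k0 i.
  by have := k0 i; rewrite !mxE.
suff -> : vsof e M = <<w>>%VS by rewrite (eqnP fw) size_tuple.
apply/eqP; rewrite eqEsubv; apply/andP; split; apply/subvP => v.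
  rewrite -(rVof_sub be) -(eq_row_base M) => /submxP [D vD].
  rewrite -(rVofK be v) vD.
  have -> : D = \row_i D 0 i by apply/rowP => i; rewrite mxE.
  rewrite -wE; apply: memv_suml => i _; apply/memvZ/memv_span.
  by apply: mem_nth; rewrite size_tuple.
apply/subvP/span_subvP => _ /mapP [i _ ->].
by rewrite -(rVof_sub be) (vecofK be) -(eq_row_base M) row_sub.
Qed.

Section Dot.
Variables (R : realType) (I : finType).
Implicit Types f g : {ffun I -> R^o}.
Local Notation n := (\dim {: {ffun I -> R^o}}).

Definition ffdot f g : R := \sum_x f x * g x.

Definition ffdelta (x : I) : {ffun I -> R^o} := [ffun y => (x == y)%:R].

Lemma ffdot_delta f x : ffdot f (ffdelta x) = f x.
Proof.
rewrite /ffdot (bigD1 x) //= ffunE eqxx mulr1 big1 ?addr0 // => y ne.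
by rewrite ffunE eq_sym (negPf ne) mulr0.
Qed.

Lemma exists_onbasis : exists2 e : n.-tuple {ffun I -> R^o},
  basis_of fullv e & forall i j : 'I_n, ffdot e`_i e`_j = (i == j)%:R :> R.
Proof.
pose s := [seq ffdelta x | x <- enum I].
have dimI : \dim {: {ffun I -> R^o}} = #|I| by rewrite dimvf /dim /= muln1.
have szs : size s == n by rewrite size_map -cardE dimI.
have nths i : (i < #|I|)%N -> exists2 x, s`_i = ffdelta x & index x (enum I) = i.
  move=> ltiI; have [x0 _] : exists x : I, true.
    by case: (pickP (fun _ : I => true)) => [x|/eq_card0 I0]; [exists x | rewrite I0 in ltiI].
  exists (nth x0 (enum I) i); first by rewrite (nth_map x0) // -cardE.
  by rewrite index_uniq ?enum_uniq // -cardE.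
exists (Tuple szs) => /=.
  rewrite basisEdim /= (eqP szs) leqnn andbT.
  apply/subvP => f _.
  have -> : f = \sum_x f x *: ffdelta x.
    apply/ffunP => y; rewrite sum_ffunE (bigD1 y) //= !ffunE eqxx.
    rewrite big1 => [|x ne]; first by rewrite addr0 /GRing.scale /= mulr1.
    by rewrite !ffunE (negPf ne) scaler0.
  apply: memv_suml => x _; apply/memvZ/memv_span.
  by apply: map_f; rewrite mem_enum.
move=> i j.
have [x -> xi] : exists2 x, s`_i = ffdelta x & index x (enum I) = i.
  by apply: nths; rewrite -dimI.
have [y -> yj] : exists2 y, s`_j = ffdelta y & index y (enum I) = j.
  by apply: nths; rewrite -dimI.
rewrite ffdot_delta ffunE -val_eqE /= -xi -yj; congr (_ %:R).
congr nat_of_bool; apply/eqP/eqP => [->//|].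
by move=> /(congr1 (nth x (enum I))); rewrite !nth_index ?mem_enum.
Qed.

Lemma selfadjoint_spectrum (L : 'End({ffun I -> R^o})) :
  (forall f g, ffdot (L f) g = ffdot f (L g)) ->
  exists s : seq R, [/\ sorted <=%R s, size s = #|I|
     & forall a, count_mem a s = \dim (leigenspace L a)].
Proof.
move=> adjL; have [e be on] := exists_onbasis.
have mxE' i j : mxof e e L i j = ffdot (L e`_i) e`_j.
  rewrite mxE /= mxE vecof_delta.
  rewrite {2}(coord_basis be (memvf (L e`_i))) /ffdot.
  under eq_bigr do rewrite sum_ffunE mulr_suml.
  rewrite exchange_big /= (bigD1 j) //= [X in _ + X]big1 ?addr0 => [|k ne].
    under eq_bigr do rewrite ffunE -mulrA.
    by rewrite -mulr_sumr [X in _ * X](on j j) eqxx mulr1.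
  under eq_bigr do rewrite ffunE -mulrA.
  by rewrite -mulr_sumr [X in _ * X](on k j) (negPf ne) mulr0.
have [|s [ss sz cs]] := @symmetric_mx_spectrum R _ (mxof e e L).
  move=> i j; rewrite !mxE' adjL /ffdot.
  by apply: eq_bigr => x _; rewrite mulrC.
exists s; split => //; first by rewrite sz dimvf /dim /= muln1.
move=> a; rewrite cs (leigenspaceE be).
by rewrite dim_vsof.
Qed.
End Dot.

Section SteklovFacts.
Variables (R : realType) (V : finType) (e : rel V).
Hypothesis esym : symmetric e.
Hypothesis econn : forall x y, connect e x y.

Notation lap := (@laplacian R V e).
Notation fV := {ffun V -> R^o}.
Notation fB := {ffun bvertex e -> R^o}.

Lemma laplacian_linear x (a : R) (f g : fV) :
  lap (a *: f + g) x = a * lap f x + lap g x.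
Proof.
rewrite /laplacian mulr_sumr -big_split /=; apply: eq_bigr => y _.
by rewrite !ffunE /GRing.scale /=; ring.
Qed.

Lemma normal_derivative_linear x (a : R) (f g : fV) :
  normal_derivative e (a *: f + g) x =
  a * normal_derivative e f x + normal_derivative e g x.
Proof.
rewrite /normal_derivative mulr_sumr -big_split /=; apply: eq_bigr => y _.
by rewrite !ffunE /GRing.scale /=; ring.
Qed.

Lemma interiorE x : (x \in interior e) = (x \notin boundary e).
Proof. by rewrite inE. Qed.

(* The edges on which the Dirichlet form lives. *)
Let w x y := e x y && ((x \in interior e) || (y \in interior e)).

Let form (f g : V -> R) : R :=
  \sum_x \sum_(y | w x y) (f x - f y) * (g x - g y).

Let wsym x y : w x y = w y x.
Proof. by rewrite /w esym orbC. Qed.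

Lemma green (f g : V -> R) :
  (forall x, x \in interior e -> lap f x = 0) ->
  form f g = 2 * \sum_(x in boundary e) normal_derivative e f x * g x.
Proof.
move=> hf.
have E1 : \sum_x \sum_(y | w x y) (f x - f y) * g x =
    \sum_(x in boundary e) normal_derivative e f x * g x.
  rewrite (bigID [in boundary e]) /= [X in _ + X]big1 ?addr0 => [|x].
    apply: eq_bigr => x xb; rewrite /normal_derivative mulr_suml.
    apply: eq_bigl => y; rewrite /w interiorE xb /=.
    by rewrite andbC.
  rewrite -interiorE => xi; rewrite -mulr_suml.
  have := hf x xi; rewrite /laplacian => h.
  rewrite (eq_bigl (e x)) ?h ?mul0r // => y.
  by rewrite /w xi /= andbT.
have E2 : \sum_x \sum_(y | w x y) (f x - f y) * g y =
    - \sum_x \sum_(y | w x y) (f x - f y) * g x.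
  rewrite (exchange_big_dep xpredT) //= -sumrN; apply: eq_bigr => x _.
  rewrite -sumrN; apply: eq_big => [y|y _]; first exact: wsym.
  by rewrite -mulNr opprB.
rewrite -E1 mulr2n mulrDl mul1r -[X in _ = _ + X]opprK -E2 -sumrN -big_split.
apply: eq_bigr => x _ /=; rewrite -sumrN -big_split /=.
by apply: eq_bigr => y _; rewrite mulrBr.
Qed.

Lemma harmonic_eq0 (h : fV) (b : V) : b \in boundary e ->
  (forall x, x \in interior e -> lap h x = 0) ->
  (forall x, x \in boundary e -> h x = 0) -> h = 0.
Proof.
move=> bb hi hb.
have /eqP := green h hi; rewrite [X in 2 * X]big1 => [|x xb]; last by rewrite hb ?mulr0.
rewrite mulr0 psumr_eq0 => [/allP /= h0|x _]; last first.
  by apply: sumr_ge0 => y _; rewrite -expr2 sqr_ge0.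
have he x y : e x y -> h x = h y.
  move=> exy; have [wxy|] := boolP (w x y).
    have := h0 x (mem_index_enum x); rewrite psumr_eq0 => [/allP /= h1|z _].
      have := h1 y (mem_index_enum y); rewrite wxy /=.
      by rewrite mulf_eq0 orbb subr_eq0 => /eqP.
    by rewrite -expr2 sqr_ge0.
  rewrite /w exy /= negb_or !interiorE !negbK => /andP [xb yb].
  by rewrite !hb.
apply/ffunP => x; rewrite ffunE; have /connectP [p pp ->] := econn b x.
suff -> : h (last b p) = h b by rewrite hb.
elim: p b {bb} pp => //= y p IH b /andP [eby pp].
by rewrite IH // (he b y).
Qed.

Lemma harmonic_extensionP (g : fB) :
  is_harmonic_extension g (harmonic_extension g).
Proof.
rewrite /harmonic_extension; case: xgetP => [h _ //|none].
pose bvals (h : fV) : fV :=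
  [ffun x => if x \in boundary e then h x else lap h x].
have lin : linear bvals.
  move=> a f1 f2; apply/ffunP => x; rewrite !ffunE.
  by case: ifP => // _; rewrite laplacian_linear.
pose L : {linear fV -> fV} := HB.pack bvals
  (GRing.isLinear.Build R fV fV *:%R bvals lin).
have [[b bb]|nob] := pselect (exists b, b \in boundary e); last first.
  case: (none (0 : fV)); split=> [x _|x].
    by rewrite /laplacian big1 // => y _; rewrite !ffunE subr0.
  by case: nob; exists (val x); apply: (valP x).
have kerL : lker (linfun L) == 0%VS.
  apply/lker0P => f1 f2; rewrite !lfunE => /eqP; rewrite -subr_eq0 -linearB.
  move=> /eqP/ffunP eq0; apply/eqP; rewrite -subr_eq0; apply/eqP.
  apply: (@harmonic_eq0 _ b) => // x xP; have := eq0 x; rewrite !ffunE.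
    by move: xP; rewrite interiorE => /negPf ->.
  by rewrite xP.
pose g' : fV := [ffun x => if insub x is Some u then g u else 0].
pose h := ((linfun L)^-1)%VF g'.
have hE : bvals h = g'.
  by have := lker0_lfunVK kerL g'; rewrite lfunE.
case: (none h); split => [x xi|x].
  have /ffunP/(_ x) := hE; rewrite !ffunE.
  move: xi; rewrite interiorE => xb; rewrite (negPf xb) => ->.
  by rewrite insubN.
have /ffunP/(_ (val x)) := hE; rewrite !ffunE (valP x) => ->.
by rewrite valK.
Qed.

Lemma harmonic_extension_unique (g : fB) (h : fV) (b : V) :
  b \in boundary e -> is_harmonic_extension g h -> h = harmonic_extension g.
Proof.
move=> bb [hi hb]; have [ki kb] := harmonic_extensionP g.
apply/eqP; rewrite -subr_eq0 addrC -scaleN1r; apply/eqP.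
apply: (harmonic_eq0 bb) => x xP.
  by rewrite laplacian_linear hi // ki // mulr0 addr0.
rewrite !ffunE -[x]/(val (Sub x xP : bvertex e)) kb hb.
by rewrite /GRing.scale /= mulN1r addNr.
Qed.

Lemma dtn_fun_linear : linear (@dtn_fun R V e).
Proof.
move=> a g1 g2; apply/ffunP => x; rewrite !ffunE.
have [i1 b1] := harmonic_extensionP g1; have [i2 b2] := harmonic_extensionP g2.
rewrite -(@harmonic_extension_unique _
  (a *: harmonic_extension g1 + harmonic_extension g2) (val x)).
- exact: normal_derivative_linear.
- exact: (valP x).
- split=> [y yi|y]; first by rewrite laplacian_linear i1 // i2 // mulr0 addr0.
  by rewrite !ffunE b1 b2.
Qed.

Lemma dtnE (g : fB) (x : bvertex e) :
  dtn R e g x = normal_derivative e (harmonic_extension g) (val x).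
Proof.
pose L : {linear fB -> fB} := HB.pack (@dtn_fun R V e)
  (GRing.isLinear.Build R fB fB *:%R (@dtn_fun R V e) dtn_fun_linear).
by rewrite /dtn -[dtn_fun (e := e)]/(L : fB -> fB) lfunE /= ffunE.
Qed.

Lemma dtn_selfadjoint (f g : fB) :
  ffdot (dtn R e f) g = ffdot f (dtn R e g).
Proof.
have E (f1 g1 : fB) : ffdot (dtn R e f1) g1 = 2^-1 *
    form (harmonic_extension f1) (harmonic_extension g1).
  have [i1 b1] := harmonic_extensionP f1; have [i2 b2] := harmonic_extensionP g1.
  rewrite green // mulrA mulVf ?pnatr_eq0 // mul1r.
  rewrite [RHS]big_sub /ffdot; apply: eq_bigr => x _.
  by rewrite dtnE b2.
have C (f1 g1 : fB) : ffdot f1 g1 = ffdot g1 f1.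
  by apply: eq_bigr => x _; rewrite mulrC.
rewrite E [RHS]C E; congr (_ * _); apply: eq_bigr => x _.
by apply: eq_bigr => y _; rewrite mulrC.
Qed.

Lemma steklov_spectrumP : is_steklov_spectrum e (steklov_spectrum R e).
Proof.
rewrite /steklov_spectrum; case: xgetP => [s _ //|none].
have [s [ss sz cs]] := selfadjoint_spectrum dtn_selfadjoint.
case: (none s); split=> //.
by rewrite sz card_sig; apply: eq_card => x; rewrite !inE.
Qed.

End SteklovFacts.

(* Main.v *)
From HB Require Import structures.
Require Import Defs.
From mathcomp Require Import all_boot all_order all_algebra.
From mathcomp Require Import reals.
From mathcomp Require Import zify ring lra.

Import Order.TTheory GRing.Theory Num.Theory.
Import passmx.

Local Open Scope ring_scope.

(** Let [B] be the number of leaves.  The degrees of a tree on [V] sum to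
    [2 (|V| - 1)]; since interior degrees are at least 3, this forces
    [|V| + 2 <= 2 B] ([boundary_ge]).  So it suffices to bound the k-th
    eigenvalue by [8 (D - 1)^2 (k - 1) / B].

    By the Courant-Fischer principle and Dirichlet's principle, it is enough to
    find a k-dimensional space of functions on [V], determined by their boundary
    values, whose energy is at most that constant times the sum of their squares
    over the leaves ([steklov_eigenvalue_le]).  For [k = 1] constants will do.

    For larger [k], root the tree at an interior vertex and cut it greedily from
    the leaves upwards: a vertex is cut off, with what is still attached below
    it, as soon as this contains at least [L] leaves.  Then each part that is
    cut off has at least [L] leaves, but not more than [D (L - 1)] if [L] is at
    least 2, so that there are many parts ([card_cuts_ge]).  The parts form a tree,
    hence at least half of them have at most one child part
    ([card_few_child_parts]) and are attached to the rest by at most two edges.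
    The functions constant on each of [k] such parts, and zero elsewhere, have
    energy at most [4 / L] times their boundary mass ([steklov_eigenvalue_parts]); the factor 4 instead
    of 2 accounts for parts that are adjacent to each other.  The least [L] with
    [4 / L] at most the constant above leaves enough parts to choose from. *)

(** * Rayleigh quotients of self-adjoint operators *)

Section Rayleigh.
Context {R : realType} {I : finType}.
Implicit Types f g : {ffun I -> R^o}.

Lemma ffdotC f g : ffdot f g = ffdot g f.
Proof. by apply: eq_bigr => x _; rewrite mulrC. Qed.

Lemma ffdotZl (a : R) f g : ffdot (a *: f) g = a * ffdot f g.
Proof.
by rewrite /ffdot mulr_sumr; apply: eq_bigr => x _; rewrite ffunE -mulrA.
Qed.

Lemma ffdot_suml (J : finType) (F : J -> {ffun I -> R^o}) g :
  ffdot (\sum_j F j) g = \sum_j ffdot (F j) g.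
Proof.
rewrite /ffdot exchange_big /=; apply: eq_bigr => x _.
by rewrite sum_ffunE mulr_suml.
Qed.

Lemma ffdot_ge0 f : 0 <= ffdot f f.
Proof. by apply: sumr_ge0 => x _; rewrite -expr2 sqr_ge0. Qed.

Lemma ffdot_eq0 f : ffdot f f = 0 -> f = 0.
Proof.
move=> /eqP; rewrite psumr_eq0 => [/allP /= f0|x _]; last first.
  by rewrite -expr2 sqr_ge0.
apply/ffunP => x; have := f0 x (mem_index_enum x).
by rewrite mulf_eq0 orbb ffunE => /eqP.
Qed.

Section Spectrum.
Variables (L : 'End({ffun I -> R^o})) (s : seq R).
Hypothesis adjL : forall f g, ffdot (L f) g = ffdot f (L g).
Hypothesis sorted_s : sorted <=%R s.
Hypothesis size_s : size s = #|I|.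
Hypothesis mult_s : forall a, count_mem a s = \dim (leigenspace L a).

Lemma leigenspace_mulP a f : f \in leigenspace L a -> L f = a *: f.
Proof.
rewrite memv_ker add_lfunE opp_lfunE scale_lfunE id_lfunE subr_eq0.
by move=> /eqP.
Qed.

Lemma leigenspace_orth a b f g : a != b ->
  f \in leigenspace L a -> g \in leigenspace L b -> ffdot f g = 0.
Proof.
move=> ab /leigenspace_mulP Lf /leigenspace_mulP Lg.
have := adjL f g; rewrite Lf Lg ffdotZl [in RHS]ffdotC ffdotZl [in RHS]ffdotC.
move/eqP; rewrite -subr_eq0 -mulrBl mulf_eq0 subr_eq0 (negPf ab) /=.
by move/eqP.
Qed.

Lemma count_sum_mult (t : seq R) : uniq t ->
  (\sum_(a <- t) count_mem a s = count (mem t) s)%N.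
Proof.
move=> ut; under eq_bigr do rewrite -sum1_count big_mkcond.
rewrite exchange_big /= -sum1_count [RHS]big_mkcond /=.
apply: eq_bigr => x _; rewrite -big_mkcond sum1_count.
rewrite (eq_count (a2 := pred1 x)) => [|a]; last by rewrite /= eq_sym.
by rewrite count_uniq_mem // -/(x \in t); case: (x \in t).
Qed.

(** One half of the Courant-Fischer principle.  If the k-th eigenvalue exceeded
    [c], the eigenspaces above [c] would span a space of codimension below [k];
    it would meet [U] in a nonzero vector, whose Rayleigh quotient is above [c]
    by orthogonality of the eigenspaces and at most [c] by assumption. *)
Lemma nth_spectrum_le (U : {vspace {ffun I -> R^o}}) (c : R) k :
  (0 < k <= \dim U)%N ->
  (forall f, f \in U -> ffdot (L f) f <= c * ffdot f f) ->
  nth 0 s k.-1 <= c.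
Proof.
move=> /andP[k_gt0 k_le] ray; rewrite leNgt; apply/negP => c_lt.
have dimI : \dim {: {ffun I -> R^o}} = #|I| by rewrite dimvf /dim /= muln1.
pose t := [seq a <- undup s | c < a].
have ut : uniq t by rewrite filter_uniq // undup_uniq.
pose E (i : 'I_(size t)) := leigenspace L t`_i.
pose T := (\sum_i E i)%VS.
have tneq (i j : 'I_(size t)) : i != j -> t`_i != t`_j.
  by move=> ij; rewrite nth_uniq.
have dT : directv T.
  apply/directv_sum_independent => u Eu sum0 i _.
  apply: ffdot_eq0; have := ffdot_suml _ u (u i); rewrite sum0.
  rewrite (bigD1 i) //= [X in _ + X]big1 ?addr0 => [<-|j ji].
    by apply: big1 => x _; rewrite ffunE mul0r.
  by apply: (@leigenspace_orth _ _ _ _ (tneq _ _ ji)); apply: Eu.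
have dimT : \dim T = count (mem t) s.
  rewrite (directvP dT) /= -count_sum_mult // (big_nth 0) big_mkord.
  by apply: eq_bigr => i _; rewrite mult_s.
have k_s : (k.-1 < size s)%N.
  by rewrite size_s -dimI prednK // (leq_trans k_le) // dimvS // subvf.
(* The list is sorted, so every entry from the k-th on is above [c]. *)
have cnt : (size s - k.-1 <= count (mem t) s)%N.
  rewrite -[in leqRHS](cat_take_drop k.-1 s) count_cat -size_drop.
  suff /eqP -> : count (mem t) (drop k.-1 s) == size (drop k.-1 s).
    exact: leq_addl.
  rewrite -all_count; apply/(all_nthP 0) => i; rewrite size_drop nth_drop.
  move=> lt_i.
  have lt_s : (k.-1 + i < size s)%N by rewrite -ltn_subRL.
  rewrite inE mem_filter mem_undup mem_nth // andbT (lt_le_trans c_lt) //.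
  by rewrite (sorted_leq_nth le_trans le_refl) ?inE // leq_addr.
have dim_gt0 (m n u a b : nat) : (n - k.-1 <= m)%N -> (k <= u)%N ->
    (k.-1 < n)%N -> (a <= n)%N -> (a + b = m + u)%N -> (0 < b)%N by lia.
have : (0 < \dim (T :&: U))%N.
  apply: dim_gt0 cnt k_le k_s _ (_ : \dim (T + U) + _ = _)%N.
    by rewrite size_s -dimI dimvS // subvf.
  by rewrite dimv_sum_cap dimT.
rewrite lt0n dimv_eq0 -vpick0 => v_neq0.
have /memv_capP[] := memv_pick (T :&: U)%VS; set v := vpick _ in v_neq0 *.
move=> /memv_sumP[u Eu vE] /ray.
have normv : ffdot v v = \sum_(i < size t) ffdot (u i) (u i).
  rewrite {1}vE ffdot_suml; apply: eq_bigr => i _.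
  rewrite vE ffdotC ffdot_suml (bigD1 i) //= big1 ?addr0 // => j ji.
  by apply: (@leigenspace_orth _ _ _ _ (tneq _ _ ji)); apply: Eu.
have normLv : ffdot (L v) v = \sum_(i < size t) t`_i * ffdot (u i) (u i).
  have -> : L v = \sum_(i < size t) t`_i *: u i.
    rewrite vE linear_sum; apply: eq_bigr => i _.
    by apply: leigenspace_mulP; apply: Eu.
  rewrite ffdot_suml; apply: eq_bigr => i _; rewrite ffdotZl; congr (_ * _).
  rewrite vE ffdotC ffdot_suml (bigD1 i) //= big1 ?addr0 // => j ji.
  by apply: (@leigenspace_orth _ _ _ _ (tneq _ _ ji)); apply: Eu.
have t_gt i : (i < size t)%N -> c < t`_i.
  by move=> /(mem_nth 0); rewrite mem_filter => /andP[].
rewrite normLv normv mulr_sumr leNgt => /negP; apply.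
have [j uj|u0] := pickP (fun j => 0 < ffdot (u j) (u j)); last first.
  case/eqP: v_neq0; rewrite vE big1 // => i _; apply: ffdot_eq0.
  by apply/eqP; rewrite eq_le ffdot_ge0 andbT leNgt u0.
rewrite (bigD1 j) //= [ltRHS](bigD1 j) //= ltr_leD //.
  by rewrite ltr_pM2r // t_gt.
by apply: ler_sum => i _; rewrite ler_wpM2r ?ffdot_ge0 // ltW // t_gt.
Qed.
End Spectrum.
End Rayleigh.

(** * Test functions for Steklov eigenvalues *)

Section Variational.
Context {R : realType} {V : finType} {e : rel V}.
Hypothesis esym : symmetric e.
Hypothesis econn : forall x y, connect e x y.

(** The sum runs over ordered pairs, so it is twice the sum over the edges. *)
Definition energy (f : V -> R) : R := \sum_x \sum_(y | e x y) (f x - f y) ^+ 2.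

Definition boundary_trace (f : {ffun V -> R^o}) : {ffun bvertex e -> R^o} :=
  [ffun b => f (val b)].

Lemma boundary_trace_linear : linear boundary_trace.
Proof. by move=> a f g; apply/ffunP => b; rewrite !ffunE. Qed.

Lemma ffdot_boundary_trace f :
  ffdot (boundary_trace f) (boundary_trace f) = \sum_(b in boundary e) f b ^+ 2.
Proof. by rewrite [RHS]big_sub; apply: eq_bigr => b _; rewrite !ffunE. Qed.

(** Dirichlet's principle: the harmonic extension [h] minimizes the energy among
    the extensions of its boundary values.  By Green's formula the left-hand
    side is the Dirichlet form of [h] with any such extension, so its gap to the
    form of [f] is the form of [f - h].  Passing to [energy] only adds edges
    that join two boundary vertices. *)
Lemma dtn_dirichlet_le (f : {ffun V -> R^o}) :
  2 * ffdot (dtn R e (boundary_trace f)) (boundary_trace f) <= energy f.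
Proof.
set h := harmonic_extension (boundary_trace f).
have [hi hb] : is_harmonic_extension (boundary_trace f) h.
  exact: harmonic_extensionP.
have hg (g : V -> R) : (forall b, b \in boundary e -> g b = f b) ->
    2 * ffdot (dtn R e (boundary_trace f)) (boundary_trace f) =
    \sum_x \sum_(y | e x y && ((x \in interior e) || (y \in interior e)))
      (h x - h y) * (g x - g y).
  move=> gb; rewrite (green esym) //; congr (_ * _).
  rewrite [RHS]big_sub /ffdot; apply: eq_bigr => b _.
  by rewrite dtnE // ffunE gb // (valP b).
have hh : forall b, b \in boundary e -> h b = f b.
  by move=> b bb; have := hb (Sub b bb); rewrite ffunE.
apply: (@le_trans _ _ (\sum_x
    \sum_(y | e x y && ((x \in interior e) || (y \in interior e)))
      (f x - f y) ^+ 2)); last first.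
  apply: ler_sum => x _; rewrite [leRHS](bigID (fun y =>
    (x \in interior e) || (y \in interior e))) /= lerDl.
  by apply: sumr_ge0 => y _; rewrite sqr_ge0.
(* The form of [f - h] is the form of [f], minus twice the form of [h, f], plus
   the form of [h]; the last two are both equal to the left-hand side. *)
have -> : 2 * ffdot (dtn R e (boundary_trace f)) (boundary_trace f) =
    2 * (2 * ffdot (dtn R e (boundary_trace f)) (boundary_trace f)) -
    2 * ffdot (dtn R e (boundary_trace f)) (boundary_trace f) by ring.
rewrite {1}(hg f) // (hg h) // -subr_ge0 opprB mulr_sumr addrCA.
rewrite -sumrB -big_split.
apply: sumr_ge0 => x _; rewrite mulr_sumr -sumrB -big_split.
apply: sumr_ge0 => y _ /=.
rewrite (_ : _ + _ = (f x - f y - (h x - h y)) ^+ 2); last by ring.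
exact: sqr_ge0.
Qed.

(** Upper bounds by test functions: no harmonic extension has to be computed,
    because by Dirichlet's principle the energy of any extension dominates the
    quadratic form of the Dirichlet-to-Neumann operator.  The factor 2 makes up
    for the double counting of edges in [energy]. *)
Lemma steklov_eigenvalue_le (I : finType)
    (T : {linear {ffun I -> R^o} -> {ffun V -> R^o}}) (c : R) k :
    (0 < k <= #|I|)%N ->
    (forall a, (forall b, b \in boundary e -> T a b = 0) -> a = 0) ->
    (forall a, energy (T a) <=
       2 * c * \sum_(b in boundary e) T a b ^+ 2) ->
  steklov_eigenvalue R e k <= c.
Proof.
move=> k_bounds Tinj Ten.
pose S a := boundary_trace (T a).
have S_linear : linear S.
  by move=> a f g; rewrite /S linearP boundary_trace_linear.
pose SL : {linear {ffun I -> R^o} -> {ffun bvertex e -> R^o}} :=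
  HB.pack S (GRing.isLinear.Build R {ffun I -> R^o} {ffun bvertex e -> R^o}
    *:%R S S_linear).
have [sorted_s size_s mult_s] := @steklov_spectrumP R V e esym econn.
have kerS : lker (linfun SL) == 0%VS.
  rewrite -subv0; apply/subvP => a; rewrite memv_ker lfunE /= => /eqP Sa0.
  rewrite memv0; apply/eqP; apply: Tinj => b bb.
  by have /ffunP/(_ (Sub b bb)) := Sa0; rewrite !ffunE.
apply: (@nth_spectrum_le _ _ (dtn R e) _ _ _ _ _ (limg (linfun SL))) => //.
- exact: dtn_selfadjoint.
- by rewrite size_s card_sig; apply: eq_card => x; rewrite !inE.
- rewrite limg_dim_eq ?(eqP kerS) ?capv0 //.
  by rewrite dimvf /dim /= muln1.
move=> g /memv_imgP[a _ ->]; rewrite lfunE /= /S ffdot_boundary_trace.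
have := le_trans (dtn_dirichlet_le (T a)) (Ten a).
by rewrite -mulrA ler_pM2l.
Qed.

End Variational.

(** * Rooted trees *)

(** [edge_parent] makes the edges of [e] exactly the pairs formed by a vertex
    other than [r] and its parent.  The value of [p] at [r] is left free. *)
Record rooting {V : finType} (e : rel V) (r : V) (p : V -> V) (d : V -> nat) :
    Prop := Rooting {
  parent_edge : forall x, x != r -> e x (p x);
  edge_parent : forall x y, e x y -> (x != r /\ p x = y) \/ (y != r /\ p y = x);
  depth_parent : forall x, x != r -> d x = (d (p x)).+1 }.
Arguments parent_edge {V e r p d}.
Arguments edge_parent {V e r p d}.
Arguments depth_parent {V e r p d}.

Section Distance.
Context {V : finType} {e : rel V}.
Hypothesis econn : forall x y, connect e x y.
Variable r : V.

Definition reachable_in (x : V) (n : nat) : bool :=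
  [exists t : n.-tuple V, path e r t && (last r t == x)].

Lemma reachable_inP x n :
  reflect (exists s, [/\ size s = n, path e r s & last r s = x])
          (reachable_in x n).
Proof.
apply: (iffP existsP) => [[t /andP[pt /eqP lt]]|[s [<- ps ls]]].
  by exists t; rewrite size_tuple.
by exists (in_tuple s); rewrite /= ps ls eqxx.
Qed.

Lemma reachable_in_some x : exists n, reachable_in x n.
Proof.
have /connectP[s ps xE] := econn r x.
by exists (size s); apply/reachable_inP; exists s.
Qed.

Definition dist (x : V) : nat := ex_minn (reachable_in_some x).

Lemma dist_predecessor x : x != r -> exists2 z, e z x & dist x = (dist z).+1.
Proof.
move=> xr; rewrite {1}/dist.
case: ex_minnP => n /reachable_inP[s [<- ps ls]] min.
elim/last_ind: s ps ls min => [_ xE|s x' _]; first by rewrite /= -xE eqxx in xr.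
rewrite rcons_path last_rcons size_rcons => /andP[ps es] x'x min; subst x'.
exists (last r s) => //; congr _.+1; rewrite /dist; case: ex_minnP => m.
move=> /reachable_inP[t [tm pt lt]] min'.
apply/eqP; rewrite eqn_leq; apply/andP; split.
  rewrite -ltnS; apply: min; apply/reachable_inP; exists (rcons t x).
  by rewrite size_rcons tm rcons_path pt lt last_rcons.
by apply: min'; apply/reachable_inP; exists s.
Qed.
End Distance.

(** The parent of [x] is a neighbour that is one step closer to [r].  Were some
    edge [x y] of another kind, then the parent edges alone would lead from [x]
    and from [y] to [r]; so [x] and [y] would be joined without using the edge
    [x y], which would close a cycle. *)
Lemma tree_rooting {V : finType} {e : rel V} (r : V) :
  is_tree e -> exists p d, rooting e r p d.
Proof.
move=> [esym eirr econn eacy].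
pose d := dist econn r.
pose p x := odflt x [pick z | e z x && (d x == (d z).+1)].
have pP x : x != r -> e x (p x) /\ d x = (d (p x)).+1.
  move=> xr; rewrite /p; case: pickP => [z /andP[ezx /eqP dz]|none] /=.
    by rewrite esym.
  have [z ezx dz] := @dist_predecessor _ _ econn r x xr.
  by have := none z; rewrite ezx /d dz eqxx.
exists p, d; split=> [x|x y exy|x]; try by case/pP.
(* [e'] is [e] without the edge [x y]. *)
pose e' u v := e u v && ~~ ((u == x) && (v == y) || (u == y) && (v == x)).
have e'sym : symmetric e'.
  move=> u v; rewrite /e' esym; congr (_ && ~~ _).
  by rewrite orbC; congr (_ || _); apply: andbC.
have [/andP[xr /eqP pxy]|Nx] := boolP ((x != r) && (p x == y)); first by left.
have [/andP[yr /eqP pyx]|Ny] := boolP ((y != r) && (p y == x)); first by right.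
have to_root z : connect e' z r.
  have [n] := ubnP (d z); elim: n z => // n IH z zn.
  have [->|zr] := eqVneq z r; first exact: connect0.
  have [ez dz] := pP z zr.
  apply: (connect_trans (connect1 _) (IH (p z) _)); last by rewrite -ltnS -dz.
  rewrite /e' ez; apply/negP => /orP[] /andP[/eqP zE /eqP pzE].
    by case/negP: Nx; rewrite -zE zr pzE eqxx.
  by case/negP: Ny; rewrite -zE zr pzE eqxx.
have : connect e' x y.
  by rewrite (connect_trans (to_root x)) // (sym_connect_sym e'sym).
move=> /connectP[s0 ps0 ys0].
case/shortenP: ps0 ys0 => s ps us _ ys.
case: (@eacy (x :: s)).
  (* A path in [e'] from [x] to [y] has at least two edges. *)
  case: s ps ys {us} => [|z [|w s]] //=.
    by move=> _ yx; rewrite yx eirr in exy.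
  by move=> /andP[/andP[_ /negP n] _] yz; case: n; rewrite yz !eqxx.
rewrite /ucycle us andbT /= rcons_path -ys esym exy andbT.
by apply: sub_path ps => u v /andP[].
Qed.

Section Rooted.
Context {V : finType} {e : rel V} {r : V} {p : V -> V} {d : V -> nat}.
Hypothesis esym : symmetric e.
Hypothesis root_e : rooting e r p d.

Lemma edge_rootedE x y :
  e x y = ((x != r) && (p x == y)) || ((y != r) && (p y == x)).
Proof.
apply/idP/orP => [/(edge_parent root_e)[[-> ->]|[-> ->]]|].
- by left; rewrite eqxx.
- by right; rewrite eqxx.
- case=> /andP[xr /eqP <-]; first exact: parent_edge root_e _ _.
  by rewrite esym; apply: parent_edge root_e _ _.
Qed.

Lemma sum_edges (M : nmodType) (F : V -> V -> M) :
  \sum_x \sum_(y | e x y) F x y = \sum_(x | x != r) (F x (p x) + F (p x) x).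
Proof.
have childE x y : e x y && ~~ ((x != r) && (p x == y)) = (y != r) && (p y == x).
  rewrite edge_rootedE.
  case: (boolP ((x != r) && _)) => [/andP[xr /eqP px]|]; last by rewrite andbT.
  rewrite andbF.
  symmetry; apply/negP => /andP[yr /eqP py].
  have := depth_parent root_e _ xr; have := depth_parent root_e _ yr.
  by rewrite px py; lia.
transitivity (\sum_x (\sum_(y | (x != r) && (p x == y)) F x y +
                      \sum_(y | (y != r) && (p y == x)) F x y)).
  apply: eq_bigr => x _; rewrite (bigID (fun y => (x != r) && (p x == y))) /=.
  congr (_ + _); apply: eq_bigl => y //.
  rewrite edge_rootedE.
  by case: (boolP ((x != r) && (p x == y))); rewrite ?andbF.
rewrite big_split [RHS]big_split /=; congr (_ + _).
  rewrite [RHS]big_mkcond; apply: eq_bigr => x _.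
  case: (x != r); last by rewrite big_pred0.
  by rewrite (eq_bigl (pred1 (p x))) ?big_pred1_eq // => y; rewrite eq_sym.
rewrite (exchange_big_dep (fun y => y != r)) /= => [|x y _ /andP[] //].
apply: eq_bigr => y yr; rewrite (eq_bigl (pred1 (p y))) ?big_pred1_eq // => x.
by rewrite yr eq_sym.
Qed.

Lemma sum_deg : (\sum_x deg e x = 2 * #|V|.-1)%N.
Proof.
have -> : \sum_x deg e x = \sum_x \sum_(y | e x y) 1 :> nat.
  by apply: eq_bigr => x _; rewrite /deg cardsE sum1_card.
by rewrite sum_edges sum_nat_const mulnC (cardC1 r).
Qed.

Lemma card_children x : (#|[set y | (y != r) && (p y == x)]| <= deg e x)%N.
Proof.
apply: subset_leq_card; apply/subsetP => y; rewrite !inE => ?.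
by rewrite edge_rootedE; apply/orP; right.
Qed.

Lemma leaf_no_child x y : x \in boundary e -> x != r -> y != r -> p y != x.
Proof.
rewrite inE => /eqP degx xr yr; apply/eqP => py.
have : (#|[set p x; y]| <= deg e x)%N.
  apply: subset_leq_card; apply/subsetP => z; rewrite !inE.
  by rewrite edge_rootedE => /orP[] /eqP ->; rewrite ?xr ?yr ?py eqxx ?orbT.
rewrite degx cards2; case: (eqVneq (p x) y) => // pxy.
have := depth_parent root_e _ xr; have := depth_parent root_e _ yr.
by rewrite py pxy; lia.
Qed.

(** Recursion from the root to the leaves; the depth serves as fuel. *)
Lemma parent_recursion {T : Type} (init : V -> T) (stop : pred V) :
  exists q : V -> T, forall x,
    q x = if (x == r) || stop x then init x else q (p x).
Proof.
pose fix q (n : nat) (x : V) {struct n} : T := if n is n'.+1 then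
  if (x == r) || stop x then init x else q n' (p x) else init x.
exists (fun x => q (d x).+1 x) => x /=.
case: ifP => // /negbT; rewrite negb_or => /andP[xr _].
by rewrite {1}(depth_parent root_e _ xr).
Qed.

(** Recursion from the leaves to the root; the fuel bounds the height that is
    left below a vertex. *)
Lemma children_recursion (m : V -> nat) (trunc : nat -> nat) :
  exists w : V -> nat, forall x,
    w x = (m x + \sum_(y | (y != r) && (p y == x)) trunc (w y))%N.
Proof.
pose fix w (n : nat) (x : V) {struct n} : nat := if n is n'.+1 then
  (m x + \sum_(y | (y != r) && (p y == x)) trunc (w n' y))%N else 0%N.
pose N := (\max_x d x).+1.
have dN x : (d x < N)%N by rewrite ltnS leq_bigmax.
exists (fun x => w (N - d x)%N x) => x.
have -> : (N - d x = (N - (d x).+1).+1)%N by have := dN x; lia.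
congr (_ + _)%N; apply: eq_bigr => y /andP[yr /eqP py].
by rewrite (depth_parent root_e _ yr) py.
Qed.

End Rooted.

(** * Cutting a rooted tree into parts with many leaves *)

Section Cutting.
Context {V : finType} {e : rel V} {r : V} {p : V -> V} {d : V -> nat}.
Hypothesis esym : symmetric e.
Hypothesis root_e : rooting e r p d.
Variables (L : nat) (w : V -> nat) (q : V -> V).

(** What a child contributes to the weight of its parent: a child of weight at
    least [L] is cut off together with the part of the tree below it. *)
Definition residual (n : nat) : nat := if (n < L)%N then n else 0%N.

(* [w x] is the number of leaves that are still attached below [x] when the tree
   is cut from the leaves upwards; [q x] is the top of the part containing [x],
   that is the first cut vertex on the way from [x] to the root, or the root. *)
Hypothesis w_rec : forall x, w x = ((x \in boundary e) +
  \sum_(y | (y != r) && (p y == x)) residual (w y))%N.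
Hypothesis q_rec : forall x,
  q x = if (x == r) || (L <= w x)%N then x else q (p x).

Definition cuts : {set V} := [set x | (L <= w x)%N].

(** Each cut vertex [x] stands for the part below it, and that part is attached
    to the part with top [q (p x)]. *)
Definition child_parts (c : V) : {set V} :=
  [set x | [&& x != r, x \in cuts & q (p x) == c]].

(** Summation by parts along the recursion for [w]: if [g] is constant on each
    part, then all terms at the vertices that are not tops cancel.  With [g = 1]
    this counts the leaves, with a squared test function it gives the boundary
    mass. *)
Lemma sum_boundary_parts (M : zmodType) (g : V -> M) :
    (forall x, x != r -> x \notin cuts -> g x = g (p x)) ->
  \sum_(x in boundary e) g x =
  \sum_(x | (x == r) || (x \in cuts)) g x *+ w x.
Proof.
move=> gp.
have : \sum_x g x *+ w x = \sum_(x in boundary e) g x +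
    \sum_(x | ~~ ((x == r) || (x \in cuts))) g x *+ w x.
  under eq_bigr do rewrite w_rec mulrnDr.
  rewrite big_split [X in _ = X + _]big_mkcond /=; congr (_ + _).
    by apply: eq_bigr => x _; case: (x \in boundary e).
  under eq_bigr do rewrite -sumrMnr.
  rewrite (exchange_big_dep (fun y => y != r)) /= => [|x y _ /andP[] //].
  rewrite [RHS](eq_bigl (fun y => (y != r) && (w y < L)%N)); last first.
    by move=> y; rewrite negb_or !inE ltnNge.
  rewrite big_mkcondr; apply: eq_bigr => y yr.
  rewrite (eq_bigl (pred1 (p y))) ?big_pred1_eq => [|x]; last first.
    by rewrite yr eq_sym.
  rewrite /residual; case: ifP => // wL.
  by rewrite -gp // inE -ltnNge.
rewrite (bigID (fun x => (x == r) || (x \in cuts))) /=.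
by move/addIr => ->.
Qed.

Lemma weight_le x :
  (w x <= (x \in boundary e) + deg e x * L.-1)%N.
Proof.
rewrite w_rec leq_add2l.
rewrite (@leq_trans (\sum_(y | (y != r) && (p y == x)) L.-1)%N) //.
  apply: leq_sum => y _; rewrite /residual; case: ifP => //; lia.
rewrite sum_nat_const leq_mul2r -cardsE (card_children esym root_e).
by rewrite orbT.
Qed.

Lemma weight_leaf x : x \in boundary e -> x != r -> w x = 1%N.
Proof.
move=> xb xr; rewrite w_rec xb big_pred0 // => y; apply/negP => /andP[yr].
by apply/negP; apply: (leaf_no_child esym root_e).
Qed.

(** Cutting as soon as the weight reaches [L] keeps the parts small: the
    contribution of each child is below [L], so that no part has more than
    [D * L.-1] leaves, and there must be many parts.  The root may be the top of
    a part that is not cut off; this has fewer than [L] leaves. *)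
Lemma card_cuts_ge D : (1 < L)%N -> (0 < D)%N -> r \in interior e ->
    (forall x, (deg e x <= D)%N) ->
  (#|boundary e| <= L.-1 * (1 + #|cuts| * D))%N.
Proof.
move=> L_gt1 D_gt0 r_int degD.
have wD x : (w x <= D * L.-1)%N.
  have [xb|xi] := boolP (x \in boundary e).
    have xr : x != r.
      by apply: contraTneq r_int => <-; rewrite !inE negbK in xb *.
    by rewrite weight_leaf // muln_gt0 D_gt0; lia.
  by rewrite (leq_trans (weight_le x)) // (negPf xi) leq_mul2r degD orbT.
have cardE : #|boundary e| = (\sum_(x | (x == r) || (x \in cuts)) w x)%N.
  (* Cancellation in summation by parts needs a group, hence the cast. *)
  apply/eqP; rewrite -(eqr_nat int) -sum1_card !natr_sum.
  by apply/eqP; rewrite sum_boundary_parts.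
rewrite cardE.
have : (\sum_(x in cuts) w x <= #|cuts| * (D * L.-1))%N.
  by rewrite -sum_nat_const leq_sum.
have : (\sum_(x | (x == r) || (x \in cuts)) w x <=
    L.-1 + \sum_(x in cuts) w x)%N.
  have [rC|rC] := boolP (r \in cuts).
    rewrite (eq_bigl (mem cuts)) ?leq_addl // => x /=.
    by case: eqP => // ->; rewrite rC.
  rewrite (bigD1 r) ?eqxx //= leq_add //; first by rewrite inE in rC; lia.
  rewrite (eq_bigl (mem cuts)) // => x /=.
  by case: eqP => [->|] /=; rewrite ?andbF ?andbT // (negPf rC).
by move: (\sum_(x in _) _)%N (\sum_(x | _) _)%N => a b; nia.
Qed.

(** Every part is a child of at most one part, so a part has at most one child
    part on average. *)
Lemma card_few_child_parts :
  (#|cuts| <= 2 * #|[set c in cuts | #|child_parts c| <= 1]|)%N.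
Proof.
have : (\sum_(c in cuts) #|child_parts c| <= #|cuts|)%N.
  under eq_bigr do rewrite -sum1_card.
  rewrite (exchange_big_dep (mem cuts)) /= => [|c x _]; last first.
    by rewrite inE => /and3P[].
  rewrite -sum1_card leq_sum // => x xC.
  rewrite sum1_card (leq_trans _ (eq_leq (card1 (q (p x))))) //.
  apply: subset_leq_card; apply/subsetP => c.
  by rewrite unfold_in /= !inE => /andP[_ /and3P[_ _ /eqP->]].
pose few c := (#|child_parts c| <= 1)%N.
have -> : #|[set c in cuts | few c]| = (\sum_(c in cuts | few c) 1)%N.
  by rewrite -sum1_card; apply: eq_bigl => c; rewrite !inE.
have -> : #|cuts| =
    (\sum_(c in cuts | few c) 1 + \sum_(c in cuts | ~~ few c) 1)%N.
  by rewrite -sum1_card (bigID few).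
rewrite (bigID few) /=.
have : (2 * \sum_(c in cuts | ~~ few c) 1 <=
    \sum_(c in cuts | ~~ few c) #|child_parts c|)%N.
  rewrite big_distrr /=; apply: leq_sum => c /andP[_].
  by rewrite -ltnNge muln1.
lia.
Qed.

Section TestFunctions.
Context {R : realType}.
Variables (K : {set V}) (a : V -> R).
Hypothesis K_cuts : K \subset cuts.
Hypothesis K_few : forall c, c \in K -> (#|child_parts c| <= 1)%N.
Hypothesis a_supp : forall x, x \notin K -> a x = 0.

Lemma q_cut x : x \in cuts -> q x = x.
Proof. by rewrite inE q_rec => ->; rewrite orbT. Qed.

Lemma q_uncut x : x != r -> x \notin cuts -> q x = q (p x).
Proof. by rewrite inE [in LHS]q_rec => /negPf-> /negPf->. Qed.

(** Only the edge above a cut vertex carries energy.  An edge between values [s]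
    and [t] costs at most [2 * s ^+ 2 + 2 * t ^+ 2], and each part with top in
    [K] is an end of at most two such edges: the one to its parent part and the one
    to its child part.  This gives 4, and ordered pairs double it. *)
Lemma energy_parts_le : energy (e := e) (a \o q) <= 8%:R * \sum_x a x ^+ 2.
Proof.
rewrite /energy (sum_edges esym root_e).
have e1 : \sum_(x | x != r) (((a \o q) x - (a \o q) (p x)) ^+ 2 +
                   ((a \o q) (p x) - (a \o q) x) ^+ 2) <=
    \sum_(x | (x != r) && (x \in cuts)) (4 * a x ^+ 2 + 4 * a (q (p x)) ^+ 2).
  rewrite [leRHS]big_mkcondr; apply: ler_sum => x xr /=.
  case: ifP => [xC|/negbT xC].
    rewrite q_cut // -subr_ge0.
    rewrite (_ : _ - _ = 2 * (a x + a (q (p x))) ^+ 2); last by ring.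
    by rewrite mulr_ge0 ?sqr_ge0.
  by rewrite q_uncut // subrr expr0n addr0.
apply: le_trans e1 _; rewrite big_split /= -!mulr_sumr.
have e2 : \sum_(x | (x != r) && (x \in cuts)) a x ^+ 2 <= \sum_x a x ^+ 2.
  rewrite [leLHS]big_mkcond; apply: ler_sum => x _.
  by case: ifP => // _; rewrite sqr_ge0.
have e3 : \sum_(x | (x != r) && (x \in cuts)) a (q (p x)) ^+ 2 <=
    \sum_x a x ^+ 2.
  rewrite (partition_big (fun x => q (p x)) xpredT) //=.
  apply: ler_sum => c _.
  rewrite (eq_bigr (fun _ => a c ^+ 2)) => [|x /andP[_ /eqP ->] //].
  rewrite sumr_const.
  have [cK|/a_supp->] := boolP (c \in K); last by rewrite expr0n mul0rn.
  rewrite -[leRHS]mulr1n ler_wpMn2l ?sqr_ge0 //.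
  rewrite (leq_trans _ (K_few c cK)) // subset_leq_card //.
  by apply/subsetP => x; rewrite [in X in _ -> X]inE => /andP[/andP[-> ->] ->].
lra.
Qed.

(** A part whose top is a cut vertex has at least [L] leaves. *)
Lemma boundary_parts_ge :
  L%:R * \sum_x a x ^+ 2 <= \sum_(x in boundary e) (a \o q) x ^+ 2.
Proof.
rewrite (sum_boundary_parts _ (fun x => (a \o q) x ^+ 2)); last first.
  move=> x xr xC; by rewrite /= q_uncut.
rewrite mulr_sumr [leRHS]big_mkcond; apply: ler_sum => x _.
have [xK|/a_supp->] := boolP (x \in K); last first.
  by rewrite expr0n mulr0; case: ifP => // _; rewrite mulrn_wge0 // sqr_ge0.
have xC := subsetP K_cuts x xK.
rewrite xC orbT /= q_cut // -[leRHS]mulr_natl ler_wpM2r ?sqr_ge0 // ler_nat.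
by move: xC; rewrite inE.
Qed.

End TestFunctions.

(** The test functions are constant on the parts with top in [K] and vanish on
    the other parts. *)
Lemma steklov_eigenvalue_parts (R : realType) (K : {set V}) k :
    (forall x y, connect e x y) -> (0 < L)%N ->
    K \subset cuts -> (forall c, c \in K -> (#|child_parts c| <= 1)%N) ->
    (0 < k <= #|K|)%N ->
  steklov_eigenvalue R e k <= 4%:R / L%:R.
Proof.
move=> econn L_gt0 K_cuts K_few k_K.
pose I : finType := {x : V | x \in K}.
pose ext (a : {ffun I -> R^o}) (x : V) : R :=
  if insub x is Some u then a u else 0.
have ext_supp a x : x \notin K -> ext a x = 0 by move=> xK; rewrite /ext insubN.
pose T (a : {ffun I -> R^o}) : {ffun V -> R^o} := [ffun x => ext a (q x)].
have T_linear : linear T.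
  move=> s a b; apply/ffunP => x; rewrite !ffunE /ext.
  by case: insubP => [u _ _|_]; rewrite ?ffunE ?scaler0 ?addr0.
pose TL : {linear {ffun I -> R^o} -> {ffun V -> R^o}} :=
  HB.pack T (GRing.isLinear.Build R {ffun I -> R^o} {ffun V -> R^o}
    *:%R T T_linear).
have boundaryE a : \sum_(b in boundary e) TL a b ^+ 2 =
    \sum_(b in boundary e) (ext a \o q) b ^+ 2.
  by apply: eq_bigr => b _; rewrite ffunE.
have L_gt0' : 0 < L%:R :> R by rewrite ltr0n.
apply: (@steklov_eigenvalue_le R V e esym econn I TL).
- by rewrite card_sig.
- move=> a a0; have := boundary_parts_ge K (ext a) K_cuts (ext_supp a).
  rewrite -boundaryE [leRHS]big1 => [|b bb]; last by rewrite a0 // expr0n.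
  rewrite pmulr_rle0 // => le0.
  have /allP/= ext0 :
      all (fun x => xpredT x ==> (ext a x ^+ 2 == 0)) (index_enum V).
    rewrite -psumr_eq0 => [|x _]; last exact: sqr_ge0.
    by rewrite eq_le le0 sumr_ge0 // => x _; rewrite sqr_ge0.
  apply/ffunP => u; have := ext0 (val u) (mem_index_enum _).
  by rewrite /ext valK sqrf_eq0 ffunE => /eqP.
- move=> a; rewrite boundaryE.
  have -> : energy (e := e) (TL a) = energy (e := e) (ext a \o q).
    by apply: eq_bigr => x _; apply: eq_bigr => y _; rewrite !ffunE.
  apply: le_trans (energy_parts_le K (ext a) K_few (ext_supp a)) _.
  have -> : 8%:R * \sum_x ext a x ^+ 2 =
      2 * (4%:R / L%:R) * (L%:R * \sum_x ext a x ^+ 2).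
    by field; rewrite gt_eqF.
  rewrite ler_wpM2l //; first by rewrite mulr_ge0 ?divr_ge0 // ?ltW.
  exact: boundary_parts_ge K (ext a) K_cuts (ext_supp a).
Qed.

End Cutting.

Arguments child_parts {V} r p L w q c.

(** * Steklov eigenvalues of trees *)

Section Tree.
Context {V : finType} {e : rel V}.
Hypothesis tree_e : is_tree e.

(** If all degrees were 1, their sum [2 * #|V|.-1] would be [#|V|]. *)
Lemma exists_interior : (3 <= #|V|)%N -> exists r, r \in interior e.
Proof.
move=> V3; have [esym _ _ _] := tree_e.
have [r rI|none] := pickP (mem (interior e)); first by exists r.
have [x _|V0] := pickP (fun _ : V => true); last by rewrite (eq_card0 V0) in V3.
have [p [d root_e]] := tree_rooting x tree_e.
have := sum_deg esym root_e.
have -> : (\sum_y deg e y = #|V|)%N.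
  rewrite -sum1_card; apply: eq_bigr => y _.
  by have := none y; rewrite /= !inE => /negbFE /eqP.
by move: #|V| V3 => n; lia.
Qed.

(** The degrees sum to [2 * #|V|.-1], but to at least 1 for each leaf and 3 for
    each interior vertex. *)
Lemma boundary_ge : (0 < #|V|)%N ->
    (forall x, x \in interior e -> (3 <= deg e x)%N) ->
  (#|V| + 2 <= 2 * #|boundary e|)%N.
Proof.
move=> V_gt0 deg_ge3; have [esym _ _ _] := tree_e.
have [x _|V0] := pickP (fun _ : V => true); last first.
  by rewrite (eq_card0 V0) in V_gt0.
have [p [d root_e]] := tree_rooting x tree_e.
have := sum_deg esym root_e.
rewrite (bigID (mem (boundary e))) /=.
rewrite (eq_bigr (fun _ => 1%N)) => [|y]; last by rewrite inE => /eqP.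
have : (\sum_(y in interior e) 3 <= \sum_(y | y \notin boundary e) deg e y)%N.
  rewrite [leqRHS](eq_bigl (mem (interior e))) => [|y]; last by rewrite !inE.
  by apply: leq_sum => y /deg_ge3.
have := cardsC (boundary e); rewrite -/(interior e) sum_nat_const sum1_card.
move: #|V| #|interior e| #|boundary e| V_gt0 => n i b.
move: (\sum_(_ | _) _)%N => s.
lia.
Qed.

(** The condition on [L] forces at least [2 * k.-1 + 1] cuts, half of which have
    at most one child part.  For [L = 1] no condition is needed: every leaf is
    then a part of its own, without child parts.  An interior root is
    what makes this true of all leaves. *)
Lemma steklov_eigenvalue_tree_le (R : realType) (D L k : nat) (r : V) :
    r \in interior e -> (forall x, (deg e x <= D)%N) -> (0 < D)%N ->
    (0 < L)%N -> (0 < k <= #|boundary e|)%N ->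
    (1 < L -> L.-1 * (1 + 2 * k.-1 * D) < #|boundary e|)%N ->
  steklov_eigenvalue R e k <= 4%:R / L%:R.
Proof.
move=> r_int degD D_gt0 L_gt0 /andP[k_gt0 k_B] large.
have [esym _ econn _] := tree_e.
have [p [d root_e]] := tree_rooting r tree_e.
have [w w_rec] :=
  children_recursion root_e (fun x => x \in boundary e : nat) (residual L).
have [q q_rec] := parent_recursion root_e id (fun x => (L <= w x)%N).
pose C := cuts L w.
suff [K [KC K_few kK]] : exists K : {set V}, [/\ K \subset C,
    forall c, c \in K -> (#|child_parts r p L w q c| <= 1)%N & (k <= #|K|)%N].
  apply: (steklov_eigenvalue_parts esym root_e L w q w_rec q_rec R K k) => //.
  by rewrite k_gt0.
have [L_gt1|L_le1] := ltnP 1 L.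
  exists [set c in C | (#|child_parts r p L w q c| <= 1)%N]; split.
  - by apply/subsetP => c; rewrite inE => /andP[].
  - by move=> c; rewrite inE => /andP[].
  have := card_cuts_ge esym root_e L w w_rec D L_gt1 D_gt0 r_int degD.
  have := @card_few_child_parts V r p L w q; have := large L_gt1.
  rewrite -/C; move: #|[set _ in C | _]| #|C| #|boundary e| => n m b.
  move=> b_gt m_le b_le; rewrite leqNgt; apply/negP => n_lt.
  have : (L.-1 * (1 + m * D) <= L.-1 * (1 + 2 * k.-1 * D))%N.
    rewrite leq_mul2l leq_add2l leq_mul2r.
    by apply/orP; right; apply/orP; right; lia.
  by move=> /(leq_trans b_le); rewrite leqNgt b_gt.
exists (boundary e); split=> // [|c cb].
  apply/subsetP => c cb; rewrite inE.
  have cr : c != r by apply: contraTneq r_int => <-; rewrite !inE negbK in cb *.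
  by rewrite (weight_leaf esym root_e L w w_rec).
have cr : c != r by apply: contraTneq r_int => <-; rewrite !inE negbK in cb *.
suff -> : child_parts r p L w q c = set0 by rewrite cards0.
(* Nothing lies below a leaf, so its part is the leaf alone. *)
have qc z : q z = c -> z = c.
  have [n] := ubnP (d z); elim: n z => // n IH z zn.
  rewrite q_rec; case: ifP => // /negbT; rewrite negb_or => /andP[zr _].
  rewrite (depth_parent root_e _ zr) ltnS in zn.
  move=> /(IH _ zn) /eqP pz.
  by rewrite (negPf (leaf_no_child esym root_e _ _ cb cr zr)) in pz.
apply/setP => x; rewrite !inE; apply/negP => /and3P[xr _ /eqP/qc/eqP px].
by rewrite (negPf (leaf_no_child esym root_e _ _ cb cr xr)) in px.
Qed.
End Tree.

Theorem corollary1p6 (R : realType) (V : finType) (e : rel V) (D : nat)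
    (tree_e : is_tree e) (V_ge3 : (3 <= #|V|)%N)
    (D_gt0 : (0 < D)%N) (deg_le : forall x : V, (deg e x <= D)%N)
    (deg_ge3 : forall x : V, x \in interior e -> (3 <= deg e x)%N)
    (k : nat) (k_bounds : (1 <= k <= #|boundary e|)%N) :
  steklov_eigenvalue R e k <=
    16%:R * (D%:R - 1) ^+ 2 * (k%:R - 1) / (#|V|%:R + 2%:R).
Proof.
have [esym _ econn _] := tree_e.
have [r r_int] := exists_interior tree_e V_ge3.
have D_ge3 : (3 <= D)%N := leq_trans (deg_ge3 r r_int) (deg_le r).
have V_B := boundary_ge tree_e (ltnW (ltnW V_ge3)) deg_ge3.
have [k_le1|k_gt1] := leqP k 1.
  have -> : k = 1%N by lia.
  rewrite subrr mulr0 mul0r.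
  (* Constant functions have no energy. *)
  pose T (a : {ffun unit -> R^o}) : {ffun V -> R^o} := [ffun _ => a tt].
  have T_linear : linear T by move=> s a b; apply/ffunP => x; rewrite !ffunE.
  pose TL : {linear {ffun unit -> R^o} -> {ffun V -> R^o}} :=
    HB.pack T (GRing.isLinear.Build R {ffun unit -> R^o} {ffun V -> R^o}
      *:%R T T_linear).
  apply: (@steklov_eigenvalue_le R V e esym econn unit TL).
  - by rewrite card_unit.
  - move=> a a0; apply/ffunP => -[]; rewrite ffunE.
    have [b bb] : exists b, b \in boundary e.
      by apply/card_gt0P; case/andP: k_bounds => /leq_trans; apply.
    by have := a0 b bb; rewrite ffunE.
  move=> a; rewrite mulr0 mul0r /energy big1 // => x _.
  by rewrite big1 // => y _; rewrite !ffunE subrr expr0n.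
(* [L] is the least integer with [4 / L] at most [8 (D - 1)^2 (k - 1) / B]. *)
pose M := (2 * (D - 1) ^ 2 * (k - 1))%N.
have M_gt0 : (0 < M)%N by rewrite !muln_gt0 !subn_gt0 k_gt1 (ltnW D_ge3).
set B := #|boundary e| in V_B k_bounds.
have B_gt0 : (0 < B)%N by lia.
pose L := (B.-1 %/ M).+1.
have LM_ge : (B <= L * M)%N.
  by have := ltn_ceil B.-1 M_gt0; rewrite -/L; lia.
have LM_lt : (L.-1 * M < B)%N.
  by rewrite /L /=; have := leq_trunc_div B.-1 M; lia.
apply: (@le_trans _ _ (4%:R / L%:R)).
  apply: (steklov_eigenvalue_tree_le tree_e _ D _ _ r) => //.
  move=> L_gt1; apply: leq_ltn_trans LM_lt.
  rewrite leq_mul2l; apply/orP; right.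
  (* This comes down to [(2 k - 2) D + 1 <= 2 (D - 1)^2 (k - 1)], which holds as
     [D] is at least 3 and [k] at least 2. *)
  have [j kE] : exists j, k = j.+2 by exists k.-2; lia.
  have [c DE] : exists c, D = c.+3 by exists (D - 3)%N; lia.
  by rewrite /M kE DE !subn1 /=; nia.
have LMr : #|V|%:R + 2 <= 2 * (L%:R * M%:R) :> R.
  by rewrite -natrD -!natrM ler_nat; lia.
have ME : M%:R = 2 * (D%:R - 1) ^+ 2 * (k%:R - 1) :> R.
  by rewrite /M !natrM !natrB ?(ltnW D_ge3) ?(ltnW k_gt1) // expr2.
rewrite ler_pdivlMr; last by rewrite ltr_wpDl.
rewrite mulrAC ler_pdivrMr ?ltr0n // mulrC.
have -> : 16%:R * (D%:R - 1) ^+ 2 * (k%:R - 1) = 8%:R * M%:R :> R.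
  by rewrite ME; ring.
nra.
Qed.
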